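(* Any two straight hairy Cantor sets $X, Y\subset\mathbb{R}^2$ are ambiently homeomorphic, that is, there is a homeomorphism $\varphi:\mathbb{R}^2\to\mathbb{R}^2$ with $\varphi(X)=Y$.
   Context: A set $X\subset\mathbb{R}^2$ is called a straight hairy Cantor set if there are a Cantor set $C\subset\mathbb{R}$ and a function $l:C\to[0,+\infty)$ such that $X=\{(x,y)\in\mathbb{R}^2\mid x\in C,\ 0\le y\le l(x)\}$ and: (i) the set of $x\in C$ with $l(x)>0$ is dense in $C$; (ii) if $x\in C$ is an end point of $C$, then $l(x)=0=\limsup_{t\to x,\,t\in C}l(t)$; (iii) if $x\in C$ is not an end point of $C$, then $\limsup_{t\to x^-,\,t\in C}l(t)=\limsup_{t\to x^+,\,t\in C}l(t)=l(x)$. Here $x\in C$ is called an end point of $C$ if there is $\delta>0$ such that $(x,x+\delta)\cap C=\emptyset$ or $(x-\delta,x)\cap C=\emptyset$. *)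

(* Defs.v *)
From HB Require Import structures.
From mathcomp Require Import all_boot all_order all_algebra.
From mathcomp Require Import all_classical all_reals.
From mathcomp Require Import ereal topology normedtype.

Set Implicit Arguments.
Unset Strict Implicit.
Unset Printing Implicit Defensive.

Import Order.TTheory GRing.Theory Num.Theory.
Import numFieldNormedType.Exports.

Local Open Scope classical_set_scope.
Local Open Scope ring_scope.

(* Non-emptiness is explicit: the empty set satisfies the other three clauses. *)
Definition cantor_set (T : topologicalType) (C : set T) : Prop :=
  [/\ C !=set0, compact C, perfect_set C & totally_disconnected C].

Definition end_point (R : realType) (C : set R) (x : R) : Prop :=
  C x /\ exists2 delta : R, 0 < delta &
    `]x, x + delta[ `&` C = set0 \/ `]x - delta, x[ `&` C = set0.

(* Upper limit of l(t) as t tends to a point along the filter F with t in C,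
   computed in the extended reals since l is not assumed bounded. *)
Definition limsup_in (R : realType) (C : set R) (l : R -> R)
    (F : set_system R) : \bar R :=
  limf_esup (fun t => (l t)%:E) (within C F).

(* The length function is total on R, but only its values on C matter. *)
Definition straight_hairy_cantor_set (R : realType) (X : set (R * R)) : Prop :=
  exists (C : set R) (l : R -> R),
    [/\ cantor_set C,
        forall x, C x -> 0 <= l x &
        X = [set p | C p.1 /\ 0 <= p.2 <= l p.1]] /\
    [/\ C `<=` closure [set x | C x /\ 0 < l x],
        forall x, C x -> end_point C x ->
          l x = 0 /\ limsup_in C l x^' = 0%:E &
        forall x, C x -> ~ end_point C x ->
          limsup_in C l x^'- = (l x)%:E /\ limsup_in C l x^'+ = (l x)%:E].

Definition homeomorphism (T U : topologicalType) (f : T -> U) : Prop :=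
  exists g : U -> T,
    [/\ cancel f g, cancel g f, continuous f & continuous g].

Definition ambiently_homeomorphic (T : topologicalType) (X Y : set T) : Prop :=
  exists2 phi : T -> T, homeomorphism phi & phi @` X = Y.

(* Main.v *)
Require Import Defs.
From mathcomp Require Import all_boot all_order all_algebra.
From mathcomp Require Import all_classical all_reals.
From mathcomp Require Import ereal topology normedtype.
From mathcomp Require Import sequences exp numfun.
From mathcomp Require Import lra.

Set Implicit Arguments.
Unset Strict Implicit.
Unset Printing Implicit Defensive.

Import Order.TTheory GRing.Theory Num.Theory.
Import numFieldNormedType.Exports.

Local Open Scope classical_set_scope.
Local Open Scope ring_scope.

(** Let [X] and [Y] lie over the Cantor sets [C] and [D], and let [L] and [N] be
    their length functions, put equal to [0] off [C] and [D].  The homeomorphism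
    of the plane has the form [(x, y) |-> (h x, e^(g x) y)], with [h] an
    increasing homeomorphism of the line and [g] continuous; it maps [X] onto
    [Y] as soon as [h] maps [C] onto [D] and [N (h x) = e^(g x) L x] on [C].

    Write [reach L a b] for the supremum of [L] on [[a, b]].  The functions [h]
    and [g] come from two binary subdivisions of one interval [[-K, K]], built
    together by cutting at points off [C], resp. off [D], so that corresponding
    pieces satisfy [reach N = e^r * reach L] for a number [r] attached to the
    pair.  Everything rests on the possibility of refining such a pair of pieces
    when one of the two is cut at a given point ([matched_cut]): since the
    length function is upper semicontinuous and is approached from both sides
    at each point where it is positive, [reach N a c] takes values in every
    open interval between [0] and [reach N a b] as the point [c] of [[a, b]] off
    [D] varies ([reach_intermediate]).  Of the two halves of the given piece, one
    keeps the whole reach, and its partner keeps [r]; for the other half, [c] is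
    chosen to make the new [r] as close to the old one as wanted.

    At step [n] the change of [r] is at most [2^-n], and the steps cut near the
    middle of the first and of the second piece alternately, so that the pieces
    shrink on both sides ([matching_tree]).  Then [h] is the map that sends the
    point with a given address in the first subdivision to the point with the
    same address in the second one, and [g] is the limit of the numbers [r]
    along the address.  By upper semicontinuity the reach of the pieces around
    [x] tends to [L x], so the relation between reaches passes to the limit and
    becomes [N (h x) = e^(g x) L x] ([transfer_height]).  A point is in [C]
    exactly when all its pieces have positive reach, a property shared by
    corresponding pieces; hence [h] maps [C] onto [D] ([transfer_mem_iff]).
    The function [g] may jump at the cuts, but these are off [C]; so its
    restriction to [C] is continuous, and Tietze's theorem extends that
    restriction to the line. *)

(** * Length functions and their suprema over intervals *)

Section Profiles.
Context {R : realType}.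
Implicit Types (C D : set R) (L N : R -> R).

(** The length function of a straight hairy Cantor set, extended by [0] off its
    base. The one-sided conditions are the lower halves of the limsup
    conditions; the upper halves are contained in [profile_usc]. *)
Record hair_profile C L : Prop := HairProfile {
  profile_closed : closed C;
  profile_bounded : exists K, forall x, C x -> - K < x < K;
  profile_codense : forall a b, a < b -> exists2 c, a < c < b & ~ C c;
  profile_ge0 : forall x, 0 <= L x;
  profile_le : exists B, forall x, L x <= B;
  profile_off : forall x, ~ C x -> L x = 0;
  profile_dense : forall a b x, C x -> a < x < b ->
    exists2 t, a < t < b & 0 < L t;
  profile_usc : forall x e, 0 < e -> exists2 d, 0 < d &
    forall t, `|t - x| < d -> L t < L x + e;
  profile_left : forall x e d, 0 < L x -> 0 < e -> 0 < d ->
    exists2 t, x - d < t < x & L x - e < L t;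
  profile_right : forall x e d, 0 < L x -> 0 < e -> 0 < d ->
    exists2 t, x < t < x + d & L x - e < L t }.

Definition hairs C L : set (R * R) := [set p | C p.1 /\ 0 <= p.2 <= L p.1].

Definition reach L a b := sup [set L t | t in `[a, b]].

Lemma profile_off_near C L x : hair_profile C L -> ~ C x ->
  exists2 d, 0 < d & forall t, `|t - x| < d -> ~ C t.
Proof.
move=> P nCx; have /open_nbhs_nbhs : open_nbhs x (~` C).
  by split => //; apply: closed_openC; exact: profile_closed P.
move=> /nbhs_ballP[d /= d0 xd]; exists d => // t td; apply: xd.
by rewrite /ball /= distrC.
Qed.

Section Reach.
Variables (C : set R) (L : R -> R).
Hypothesis P : hair_profile C L.

Lemma reach_ub a b t : a <= t <= b -> L t <= reach L a b.
Proof.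
move=> atb; apply: ub_le_sup; last by exists t; rewrite //= in_itv.
by have [B LB] := profile_le P; exists B => _ [s _ <-].
Qed.

Lemma reach_le a b B : a <= b -> (forall t, a <= t <= b -> L t <= B) ->
  reach L a b <= B.
Proof.
move=> ab LB; apply: ge_sup.
  by exists (L a), a => //=; rewrite in_itv /= lexx.
by move=> _ [t /= tab <-]; apply: LB; rewrite in_itv in tab.
Qed.

Lemma lt_reach a b u : a <= b -> u < reach L a b ->
  exists2 t, a <= t <= b & u < L t.
Proof.
move=> ab; apply: contraPP => /forall2NP H; apply/negP; rewrite -leNgt.
by apply: reach_le => // t tab; case: (H t) => // /negP; rewrite -leNgt.
Qed.

Lemma reach_ge0 a b : a <= b -> 0 <= reach L a b.
Proof.
move=> ab; apply: le_trans (profile_ge0 P a) _.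
by apply: reach_ub; rewrite lexx.
Qed.

Lemma reach_split a b c : a <= c <= b ->
  reach L a b = Num.max (reach L a c) (reach L c b).
Proof.
move=> /andP[ac cb]; apply/eqP; rewrite eq_le; apply/andP; split.
  apply: reach_le => [|t /andP[at_ tb]]; first exact: le_trans ac cb.
  rewrite le_max; have [tc|ct] := leP t c; first by rewrite reach_ub ?at_.
  by rewrite (@reach_ub c b t) ?orbT// (ltW ct).
rewrite ge_max; apply/andP; split; apply: reach_le => // t /andP[t1 t2];
  apply: reach_ub; rewrite ?t1 ?t2 ?andbT /=.
  exact: le_trans t2 cb.
exact: le_trans ac t1.
Qed.

(** The case of reach zero, complementing [reach_intermediate]: a cut next to
    [a], inside the gap of [C] around [a]. *)
Lemma reach_small_left a b : a < b -> ~ C a ->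
  exists c, [/\ a < c < b, ~ C c & reach L a c = 0].
Proof.
move=> ab nCa; have [d d0 Cd] := profile_off_near P nCa.
have [c /andP[ac cm] nCc] : exists2 c, a < c < Num.min b (a + d) & ~ C c.
  by apply: (profile_codense P); rewrite lt_min ab ltrDl.
move: cm; rewrite lt_min => /andP[cb cd]; exists c; split; rewrite ?ac//.
apply/eqP; rewrite eq_le reach_ge0 ?(ltW ac)// andbT.
apply: reach_le (ltW ac) _ => t /andP[t1 t2].
by rewrite (profile_off P)//; apply: Cd; rewrite ger0_norm; lra.
Qed.

(** Upper semicontinuity forbids a jump up to the right of a point, and the
    approach from the left forbids a jump at the point itself. Concretely, with
    [w] between [u] and [v] and [s] the first point where [L] is at least [w],
    all values before [s] are below [w], while values just before [s] come
    close to [L s]; any cut shortly before [s] does. *)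
Lemma reach_intermediate a b u v : a < b -> ~ C a -> 0 <= u -> u < v ->
  v <= reach L a b -> exists c, [/\ a < c < b, ~ C c & u < reach L a c < v].
Proof.
move=> ab nCa u0 uv vM; pose w := (u + v) / 2.
have uw : u < w by rewrite /w; lra.
have wv : w < v by rewrite /w; lra.
have w0 : 0 < w by exact: le_lt_trans u0 uw.
have La : L a = 0 by exact: profile_off P _ nCa.
pose A := [set t | a <= t <= b /\ w <= L t].
have [t0 t0ab wt0] := lt_reach (ltW ab) (lt_le_trans wv vM).
have At0 : A t0 by split => //; exact: ltW.
have lbA : lbound A a by move=> t [/andP[]].
have hA : has_inf A by split; [exists t0 | exists a].
pose s := inf A.
have as_ : a <= s by apply: lb_le_inf => //; exists t0.
have st0 : s <= t0 by apply: ge_inf => //; exists a.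
have below t : a <= t -> t < s -> L t < w.
  move=> at_ ts; rewrite ltNge; apply/negP => wt.
  have : s <= t by apply: ge_inf; [exists a | split=> //; lra].
  by rewrite leNgt ts.
have ws : w <= L s.
  rewrite leNgt; apply/negP => sw.
  have [d d0 Ld] := profile_usc P s (e := w - L s) ltac:(lra).
  have [t [tab wt] ts] := inf_adherent d0 hA.
  have st : s <= t by apply: ge_inf => //; exists a.
  have : L t < L s + (w - L s) by apply: Ld; rewrite ger0_norm -/s in ts *; lra.
  by lra.
have lt_as : a < s.
  by rewrite lt_neqAle as_ andbT; apply/eqP => E; rewrite -E La in ws; lra.
have [t /andP[t1 t2] Lt] := profile_left P (x := s) (e := w - u) (d := s - a)
  ltac:(lra) ltac:(lra) ltac:(lra).
have [c /andP[tc cs] nCc] := profile_codense P t2.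
exists c; split => //; first by lra.
apply/andP; split.
  by apply: (@lt_le_trans _ _ (L t)); [lra | apply: reach_ub; lra].
apply: le_lt_trans wv; apply: reach_le => [|r /andP[r1 r2]]; first lra.
by apply/ltW/below => //; lra.
Qed.

End Reach.

(** The mirror image exchanges the left and the right half of a cut piece, which
    spares a second version of [matched_cut_left]. *)
Lemma profile_reflect C L : hair_profile C L ->
  hair_profile [set x | C (- x)] (fun x => L (- x)).
Proof.
move=> [cC [K CK] cod L0 [B LB] off den usc lft rgt]; split => //.
- by apply: (closed_comp _ cC) => x _; exact: continuousN.
- by exists K => x /CK; lra.
- by move=> a b ab; have [c cab nC] := cod (- b) (- a) ltac:(lra);
    exists (- c); [lra | rewrite /= opprK].
- by exists B.
- by move=> x nC; exact: off.
- move=> a b x Cx xab; have [t tab Lt] := den (- b) (- a) _ Cx ltac:(lra).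
  by exists (- t); [lra | rewrite opprK].
- move=> x e e0; have [d d0 H] := usc (- x) e e0; exists d => // t td.
  by apply: H; rewrite opprK addrC distrC.
- move=> x e d Lx e0 d0; have [t tx Lt] := rgt _ e d Lx e0 d0.
  by exists (- t); [lra | rewrite opprK].
- move=> x e d Lx e0 d0; have [t tx Lt] := lft _ e d Lx e0 d0.
  by exists (- t); [lra | rewrite opprK].
Qed.

Lemma reach_reflect L a b : reach (fun x => L (- x)) (- b) (- a) = reach L a b.
Proof.
congr sup; apply/seteqP; split => _ [t /= tab <-];
  rewrite in_itv /= in tab.
  by exists (- t) => //=; rewrite in_itv /=; lra.
by exists (- t); rewrite ?opprK//= in_itv /=; lra.
Qed.

(** When the right half [[c, b]] carries the whole reach, its partner only has to
    carry the whole reach of [[a', b']], which is automatic once the reach of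
    [[a', c']] is smaller. So the left half can be treated alone: [c'] is chosen
    with a reach slightly below [expR rho * reach L a c]. *)
Lemma matched_cut_left C L D N a b a' b' c rho e :
  hair_profile C L -> hair_profile D N -> 0 < e ->
  a < c < b -> a' < b' -> ~ D a' ->
  reach N a' b' = expR rho * reach L a b -> reach L a c <= reach L c b ->
  exists c' r, [/\ a' < c' < b', ~ D c', rho - e <= r <= rho,
    reach N a' c' = expR r * reach L a c &
    reach N c' b' = expR rho * reach L c b].
Proof.
move=> PL PN e0 /andP[ac cb] ab' nDa' Eab le_ac_cb.
have Lab : reach L a b = reach L c b.
  by rewrite (reach_split PL (c := c)) ?(ltW ac) ?(ltW cb)//; exact/max_idPr.
have tail c' : a' < c' < b' -> reach N a' c' < reach N a' b' ->
    reach N c' b' = expR rho * reach L c b.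
  move=> /andP[ac' cb'] lt1; rewrite -Lab -Eab.
  have := reach_split PN (a := a') (b := b') (c := c').
  rewrite (ltW ac') (ltW cb') => /(_ isT) E; rewrite E maxEle.
  by case: ifPn => //; rewrite -ltNge => /ltW/max_idPl E'; rewrite E E' ltxx in lt1.
(* A half that misses the base has no ratio; it inherits [rho]. *)
have [z|nz] := eqVneq (reach L a c) 0.
  have [c' [ac'b nDc' E0]] := reach_small_left PN ab' nDa'.
  exists c', rho; split => //; first lra.
    by rewrite z E0 mulr0.
  move/andP: (ac'b) => [ac' cb'].
  rewrite -Lab -Eab (reach_split PN (c := c') (a := a')) ?(ltW ac') ?(ltW cb')//.
  by rewrite E0; apply/esym/max_idPr/(reach_ge0 PN)/ltW.
have m0 : 0 < reach L a c by rewrite lt_neqAle eq_sym nz (reach_ge0 PL) ?(ltW ac).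
have [|||c' [ac'b nDc' /andP[lo hi]]] := @reach_intermediate _ _ PN a' b'
    (expR (rho - e) * reach L a c) (expR rho * reach L a c) ab' nDa'.
- by rewrite mulr_ge0 ?expR_ge0// ltW.
- by rewrite ltr_pM2r// ltr_expR; lra.
- by rewrite Eab Lab ler_pM2l ?expR_gt0.
exists c', (ln (reach N a' c' / reach L a c)).
have N0 : 0 < reach N a' c'.
  by apply: le_lt_trans lo; rewrite mulr_ge0 ?expR_ge0 ?ltW.
have q0 : reach N a' c' / reach L a c \is Num.pos by rewrite posrE divr_gt0.
split => //.
- rewrite -[X in X <= _ <= _]expRK -[X in _ <= _ <= X]expRK.
  by rewrite !ler_ln ?posrE ?expR_gt0 ?divr_gt0// ler_pdivlMr// ler_pdivrMr// !ltW.
- by rewrite lnK// divfK.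
- apply: tail => //; apply: lt_le_trans hi _.
  by rewrite Eab Lab ler_pM2l ?expR_gt0.
Qed.

(** The refinement step. The constant [e] bounds the change of the logarithmic
    ratio, independently of the piece and of the cut. *)
Lemma matched_cut C L D N a b a' b' c rho e :
  hair_profile C L -> hair_profile D N -> 0 < e ->
  a < c < b -> a' < b' -> ~ D a' -> ~ D b' ->
  reach N a' b' = expR rho * reach L a b ->
  exists c' r1 r2,
    [/\ a' < c' < b', ~ D c', `|r1 - rho| <= e /\ `|r2 - rho| <= e,
    reach N a' c' = expR r1 * reach L a c &
    reach N c' b' = expR r2 * reach L c b].
Proof.
move=> PL PN e0 acb ab' nDa' nDb' Eab.
have [le1|/ltW le2] := leP (reach L a c) (reach L c b).
  have [c' [r [? ? ? E1 E2]]] := matched_cut_left PL PN e0 acb ab' nDa' Eab le1.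
  by exists c', r, rho; split => //; split; rewrite ler_norml; lra.
have [] := @matched_cut_left _ _ _ _ (- b) (- a) (- b') (- a') (- c) rho e
  (profile_reflect PL) (profile_reflect PN) e0.
- lra.
- lra.
- by rewrite /= opprK.
- by rewrite !reach_reflect.
- by rewrite !reach_reflect.
move=> c' [r []]; rewrite -(opprK c') !reach_reflect /= => ? nD ? E1 E2.
exists (- c'), rho, r; split=> //; first lra.
  by rewrite -[c']opprK.
by split; rewrite ler_norml; lra.
Qed.

End Profiles.

(** * Binary subdivisions of an interval and the homeomorphisms between them *)

Section Subdivisions.
Context {R : realType}.

Lemma nested_sup (u v : nat -> R) :
  (forall n, u n <= u n.+1) -> (forall n, v n.+1 <= v n) ->
  (forall n, u n <= v n) -> forall n, u n <= sup (range u) <= v n.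
Proof.
move=> uS vS uv n.
have u_le m k : (m <= k)%N -> u m <= u k by exact: (nondecreasing_seqP u).1.
have v_le m k : (m <= k)%N -> v k <= v m by exact: (nonincreasing_seqP v).1.
have ub_v k : ubound (range u) (v k).
  move=> _ [m _ <-]; apply: (le_trans (u_le m (maxn m k) (leq_maxl _ _))).
  exact: le_trans (uv _) (v_le _ _ (leq_maxr _ _)).
apply/andP; split; first by apply: ub_le_sup; [exists (v 0%N) | exists n].
by apply: ge_sup => //; exists (u 0%N), 0%N.
Qed.

(** A binary subdivision of the interval from [lo [::]] to [hi [::]]. A piece is
    named by the list of turns leading to it, the most recent turn in front;
    [true] means right. *)
Record subdivision (lo hi : seq bool -> R) : Prop := Subdivision {
  subdiv_lt : forall w, lo w < hi w;
  subdiv_left : forall w, lo (false :: w) = lo w;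
  subdiv_right : forall w, hi (true :: w) = hi w;
  subdiv_cut : forall w, hi (false :: w) = lo (true :: w);
  subdiv_small : forall e, 0 < e -> exists n, forall w, (n <= size w)%N ->
    hi w - lo w < e }.

(** The name of the piece of depth [n] around [x]. Pieces are closed on the left,
    so that every point of the root has exactly one address. *)
Fixpoint address (lo : seq bool -> R) n x : seq bool :=
  if n is n'.+1 then let w := address lo n' x in (lo (true :: w) <= x) :: w
  else [::].

Lemma size_address lo n x : size (address lo n x) = n.
Proof. by elim: n => //= n ->. Qed.

Lemma subdiv_cons lo hi b w : subdivision lo hi ->
  lo w <= lo (b :: w) /\ hi (b :: w) <= hi w.
Proof.
move=> S; have l := subdiv_lt S (true :: w); have h := subdiv_lt S (false :: w).
rewrite (subdiv_right S) in l; rewrite (subdiv_left S) (subdiv_cut S) in h.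
case: b; rewrite ?(subdiv_left S) ?(subdiv_right S) ?(subdiv_cut S).
  by rewrite lexx (ltW h).
by rewrite lexx (ltW l).
Qed.

Lemma mem_address lo hi n x : subdivision lo hi ->
  lo [::] <= x < hi [::] -> lo (address lo n x) <= x < hi (address lo n x).
Proof.
move=> S x0; elim: n => //= n /andP[l h].
case: (leP (lo (true :: _)) x) => c; first by rewrite (subdiv_right S) h c.
by rewrite (subdiv_left S) (subdiv_cut S) l c.
Qed.

(** The point whose address for [lo'] is the address of [x] for [lo]. *)
Definition transfer lo lo' (x : R) : R :=
  sup (range (fun n => lo' (address lo n x))).

Section Transfer.
Variables (lo hi lo' hi' : seq bool -> R).
Hypotheses (S : subdivision lo hi) (S' : subdivision lo' hi').

Lemma transfer_bounds n x :
  lo' (address lo n x) <= transfer lo lo' x <= hi' (address lo n x).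
Proof.
move: n; apply: (@nested_sup (fun n => lo' (address lo n x))
  (fun n => hi' (address lo n x))) => n.
- by have [] := subdiv_cons (lo (true :: address lo n x) <= x) (address lo n x) S'.
- by have [] := subdiv_cons (lo (true :: address lo n x) <= x) (address lo n x) S'.
- exact/ltW/subdiv_lt.
Qed.

(** The pieces being half-open, the image must avoid the right end of its pieces.
    If it were such an end, the address would turn right forever from there on;
    then [x] would be a right end as well, against [mem_address]. *)
Lemma transfer_lt n x : lo [::] <= x < hi [::] ->
  transfer lo lo' x < hi' (address lo n x).
Proof.
move=> x0; rewrite ltNge; apply/negP => le_hi_T.
have const k : hi (address lo (k + n) x) = hi (address lo n x) /\
    hi' (address lo (k + n) x) = hi' (address lo n x).
  elim: k => // k [IH IH']; rewrite addSn /=; case: (leP (lo (true :: _)) x) => c.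
    by rewrite (subdiv_right S) (subdiv_right S').
  have /andP[_] := transfer_bounds (k + n).+1 x.
  rewrite /= [lo (true :: _) <= x]leNgt c (subdiv_cut S') => T1.
  have := subdiv_lt S' (true :: address lo (k + n) x).
  by rewrite (subdiv_right S') IH'; lra.
have /andP[_ xn] := mem_address n S x0.
have [m small] := subdiv_small S (e := hi (address lo n x) - x) ltac:(lra).
have /andP[xm _] := mem_address (m + n) S x0.
have := small (address lo (m + n) x); rewrite size_address leq_addr => /(_ isT).
by rewrite (const m).1; lra.
Qed.

Lemma address_transfer n x : lo [::] <= x < hi [::] ->
  address lo' n (transfer lo lo' x) = address lo n x.
Proof.
move=> x0; elim: n => //= n ->; congr (_ :: _).
have /andP[T1 _] := transfer_bounds n.+1 x; have := transfer_lt n.+1 x0.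
move: T1 => /=; case: (_ <= x) => // _.
by rewrite (subdiv_cut S') ltNge => /negbTE.
Qed.

Lemma mem_transfer x : lo [::] <= x < hi [::] ->
  lo' [::] <= transfer lo lo' x < hi' [::].
Proof.
by move=> x0; rewrite (transfer_lt 0 x0) andbT; have /andP[] := transfer_bounds 0 x.
Qed.

(** Two points with different addresses are separated from the first difference
    on, in the same order for both subdivisions. *)
Lemma transfer_homo : {homo transfer lo lo' : x y / x <= y}.
Proof.
move=> x y xy.
have sep n : address lo n x = address lo n y \/
    hi' (address lo n x) <= lo' (address lo n y).
  elim: n => [|n [E|IH]]; first by left.
    rewrite /= E; case: (leP _ x) => [/le_trans/(_ xy) ->|_]; first by left.
    by case: (leP _ y) => _; [right; rewrite (subdiv_cut S') | left].
  right; have [_] := subdiv_cons (lo (true :: address lo n x) <= x) (address lo n x) S'.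
  have [+ _] := subdiv_cons (lo (true :: address lo n y) <= y) (address lo n y) S'.
  by move=> /= ? ?; lra.
apply: ge_sup => [|_ [n _ <-]]; first by exists (lo' (address lo 0 x)), 0%N.
have /andP[ny _] := transfer_bounds n y.
case: (sep n) => [->//|].
have := subdiv_lt S' (address lo n x); lra.
Qed.

End Transfer.

Lemma subdiv_dist lo hi x e : subdivision lo hi -> lo [::] <= x < hi [::] ->
  0 < e -> exists n, forall y,
    lo (address lo n x) <= y <= hi (address lo n x) -> `|y - x| < e.
Proof.
move=> S x0 e0; have [n small] := subdiv_small S e0; exists n => y yn.
have := small (address lo n x); rewrite size_address leqnn => /(_ isT).
by have := mem_address n S x0; rewrite ltr_norml; lra.
Qed.

Lemma transfer_id lo hi x : subdivision lo hi -> lo [::] <= x < hi [::] ->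
  transfer lo lo x = x.
Proof.
move=> S x0; apply/eqP; apply: contraT; rewrite -subr_eq0 -normr_gt0 => d0.
have [n /(_ _ (transfer_bounds lo S n x))] := subdiv_dist S x0 d0.
by rewrite ltxx.
Qed.

Lemma transferK lo hi lo' hi' x : subdivision lo hi -> subdivision lo' hi' ->
  lo [::] <= x < hi [::] -> transfer lo' lo (transfer lo lo' x) = x.
Proof.
move=> S S' x0; rewrite -[RHS](transfer_id S x0) /transfer; congr sup.
by under eq_fun do rewrite (address_transfer S S' _ x0).
Qed.

(** The two subdivisions will have the same root, so the identity is the
    extension to the line that keeps order. *)
Definition extend_transfer (lo hi lo' : seq bool -> R) x : R :=
  if lo [::] <= x < hi [::] then transfer lo lo' x else x.

Section Extend.
Variables (lo hi lo' hi' : seq bool -> R).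
Hypotheses (S : subdivision lo hi) (S' : subdivision lo' hi').
Hypotheses (lo0 : lo' [::] = lo [::]) (hi0 : hi' [::] = hi [::]).

Lemma extend_transferK :
  cancel (extend_transfer lo hi lo') (extend_transfer lo' hi' lo).
Proof.
move=> x; rewrite /extend_transfer; case: (boolP (lo [::] <= x < _)) => x0; last first.
  by rewrite lo0 hi0 (negbTE x0).
by rewrite (mem_transfer S S' x0) (transferK S S' x0).
Qed.

Lemma extend_transfer_homo : {homo extend_transfer lo hi lo' : x y / x <= y}.
Proof.
move=> x y xy; rewrite /extend_transfer.
case: ifPn => x0; case: ifPn => y0 //; first exact: (transfer_homo lo S').
  by have := mem_transfer S S' x0; rewrite lo0 hi0; move: y0; lra.
by have := mem_transfer S S' y0; rewrite lo0 hi0; move: x0; lra.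
Qed.

End Extend.

Lemma homo_bij_continuous (h k : R -> R) : cancel h k -> cancel k h ->
  {homo h : x y / x <= y} -> {homo k : x y / x <= y} -> continuous h.
Proof.
move=> hK kK hh kh x.
have hlt a b : a < b -> h a < h b.
  by move=> ab; rewrite ltNge; apply/negP => /kh; rewrite !hK; lra.
have klt a b : a < b -> k a < k b.
  by move=> ab; rewrite ltNge; apply/negP => /hh; rewrite !kK; lra.
apply/cvgrPdist_lt => e e0.
have lx : k (h x - e) < x by rewrite -[X in _ < X]hK; apply: klt; lra.
have xr : x < k (h x + e) by rewrite -[X in X < _]hK; apply: klt; lra.
near=> t.
have : k (h x - e) < t by near: t; exact: lt_nbhsr.
have : t < k (h x + e) by near: t; exact: lt_nbhsl.
by move=> /hlt + /hlt; rewrite !kK ltr_norml; lra.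
Unshelve. all: by end_near. Qed.

End Subdivisions.

(** * A pair of matched subdivisions *)

Section Matching.
Context {R : realType}.

Lemma geometric_small (A q e : R) : 0 < q < 1 -> 0 < e ->
  exists n, forall m, (n <= m)%N -> `|A| * q ^+ m < e.
Proof.
move=> /andP[q0 q1] e0.
have : (fun m => `|A| * q ^+ m) @ \oo --> (`|A| * 0 : R).
  by apply: cvgMr; apply: cvg_expr; rewrite gtr0_norm.
rewrite mulr0 => /cvgrPdist_lt/(_ e e0)[n _ H]; exists n => m /H /=.
by rewrite sub0r normrN ger0_norm// mulr_ge0// exprn_ge0// ltW.
Qed.

(** A pair of corresponding intervals, one in the source and one in the target,
    together with the logarithm of the ratio of their reaches. That number is a
    datum, since two reaches equal to [0] do not determine it. *)
Record piece := Piece {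
  src_lo : R; src_hi : R; tgt_lo : R; tgt_hi : R; log_ratio : R }.

Record cut := Cut { src_cut : R; tgt_cut : R; ratio_left : R; ratio_right : R }.

Definition subpiece (b : bool) (p : piece) (q : cut) : piece :=
  if b then Piece (src_cut q) (src_hi p) (tgt_cut q) (tgt_hi p) (ratio_right q)
  else Piece (src_lo p) (src_cut q) (tgt_lo p) (tgt_cut q) (ratio_left q).

(** A cut in the middle third leaves halves of at most two thirds of the width. *)
Definition central (a b c : R) := a + (b - a) / 3 < c < b - (b - a) / 3.

Variables (C D : set R) (L N : R -> R).
Hypotheses (PL : hair_profile C L) (PN : hair_profile D N).

Definition matched (p : piece) : Prop :=
  [/\ src_lo p < src_hi p, tgt_lo p < tgt_hi p,
      ~ C (src_lo p) /\ ~ C (src_hi p), ~ D (tgt_lo p) /\ ~ D (tgt_hi p) &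
      reach N (tgt_lo p) (tgt_hi p)
        = expR (log_ratio p) * reach L (src_lo p) (src_hi p)].

(** Only one of the two cut points can be prescribed, the other one is imposed by
    the reaches; the parity of [n] says which of the two is made central. *)
Definition good_cut (n : nat) (p : piece) (q : cut) : Prop :=
  [/\ src_lo p < src_cut q < src_hi p, tgt_lo p < tgt_cut q < tgt_hi p,
      forall b, matched (subpiece b p q),
      forall b, `|log_ratio (subpiece b p q) - log_ratio p| <= 2^-1 ^+ n &
      if odd n then central (tgt_lo p) (tgt_hi p) (tgt_cut q)
      else central (src_lo p) (src_hi p) (src_cut q)].

Lemma exists_good_cut n p : matched p -> exists q, good_cut n p q.
Proof.
case: p => a b a' b' r [/= ab ab' [nCa nCb] [nDa nDb] E].
have e0 : (0 : R) < 2^-1 ^+ n by apply: exprn_gt0; lra.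
rewrite /good_cut; case: (odd n).
  have [c' cc' nDc'] : exists2 c', central a' b' c' & ~ D c'.
    by apply: (profile_codense PN); lra.
  (* Exchanging source and target changes the sign of the logarithmic ratio. *)
  have flip r' (x y : R) : x = expR r' * y -> y = expR (- r') * x.
    by move=> ->; rewrite mulrA -expRD addNr expR0 mul1r.
  have acb' : a' < c' < b' by rewrite /central in cc'; lra.
  have [c [r1 [r2 [acb nCc [d1 d2] E1 E2]]]] :=
    matched_cut PN PL e0 acb' ab nCa nCb (flip _ _ _ E).
  exists (Cut c c' (- r1) (- r2)); split => //=.
  by case; split => //=; try exact: flip; lra.
  by case => /=; rewrite distrC opprK addrC; rewrite opprK in d1 d2.
have [c cc nCc] : exists2 c, central a b c & ~ C c.
  by apply: (profile_codense PL); lra.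
have acb : a < c < b by rewrite /central in cc; lra.
have [c' [r1 [r2 [acb' nDc [d1 d2] E1 E2]]]] :=
  matched_cut PL PN e0 acb ab' nDa nDb E.
exists (Cut c c' r1 r2); split => //=.
by case; split => //=; lra.
by case.
Qed.

Variable root : piece.
Hypothesis matched_root : matched root.

(** Every second cut is central on a given side, so after [n] steps a width has
    been multiplied at least [n./2] times by at most two thirds. *)
Lemma matching_tree : exists t : seq bool -> piece,
  [/\ t [::] = root, forall w, matched (t w),
      subdivision (src_lo \o t) (src_hi \o t),
      subdivision (tgt_lo \o t) (tgt_hi \o t) &
      forall b w, `|log_ratio (t (b :: w)) - log_ratio (t w)| <= 2^-1 ^+ size w].
Proof.
have /choice[f fP] : forall np : nat * piece, exists q,
    matched np.2 -> good_cut np.1 np.2 q.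
  move=> [n p]; have [/(exists_good_cut n)[q ?]|?] := pselect (matched p).
    by exists q.
  by exists (Cut 0 0 0 0).
pose t := fix t w :=
  if w is b :: w' then subpiece b (t w') (f (size w', t w')) else root.
have mt w : matched (t w).
  by elim: w => [//|b w IH]; have [_ _ /(_ b)] := fP (size w, t w) IH.
have gt w : good_cut (size w) (t w) (f (size w, t w)).
  exact: (fP (size w, t w) (mt w)).
have widths w :
    src_hi (t w) - src_lo (t w)
      <= (src_hi root - src_lo root) * (2 / 3) ^+ uphalf (size w) /\
    tgt_hi (t w) - tgt_lo (t w)
      <= (tgt_hi root - tgt_lo root) * (2 / 3) ^+ (size w)./2.
  elim: w => [|b w [IH1 IH2]]; first by rewrite /= !expr0 !mulr1.
  have [s1 s2 _ _ s3] := gt w.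
  set q := f _ in s1 s2 s3; set u := (_ * _) in IH1; set u' := (_ * _) in IH2.
  have narrow b' : src_hi (subpiece b' (t w) q) - src_lo (subpiece b' (t w) q) <= u
      /\ tgt_hi (subpiece b' (t w) q) - tgt_lo (subpiece b' (t w) q) <= u'.
    by case: b' => /=; clear - s1 s2 IH1 IH2; split; lra.
  rewrite /=; case: (boolP (odd (size w))) s3 => odd_w s3.
    have uE : uphalf (size w) = (size w)./2.+1 by rewrite uphalf_half odd_w.
    split; first by rewrite -uE; exact: (narrow b).1.
    rewrite uE exprS mulrCA -/u'.
    by case: b; rewrite /= /central in s3 *; clear - s3 IH2; lra.
  have uE : uphalf (size w) = (size w)./2 by rewrite uphalf_half (negbTE odd_w).
  split; last by rewrite uE; exact: (narrow b).2.
  rewrite exprS mulrCA -uE -/u.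
  by case: b; rewrite /= /central in s3 *; clear - s3 IH1; lra.
have small A (wd : seq bool -> R) (g : nat -> nat) :
    (forall w, wd w <= A * (2 / 3) ^+ g (size w)) ->
    (forall n, (n./2 <= g n)%N) ->
    forall e, 0 < e -> exists n, forall w, (n <= size w)%N -> wd w < e.
  move=> wdA gn e e0.
  have [n small_n] := @geometric_small A (2 / 3) e ltac:(lra) e0.
  exists n.*2 => w nw; apply: le_lt_trans (wdA w) _.
  apply: le_lt_trans (small_n (g (size w)) _).
    by rewrite ler_wpM2r ?exprn_ge0 ?ler_norm//; lra.
  by apply: leq_trans (gn _); rewrite -[n]doubleK half_leq.
exists t; split => //.
- split => //=; try by move=> w; have [] := mt w.
  apply: (small _ _ uphalf (fun w => (widths w).1)) => n.
  by rewrite uphalf_half leq_addl.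
- split => //=; try by move=> w; have [] := mt w.
  exact: (small _ _ half (fun w => (widths w).2)).
- by move=> b w; have [_ _ _ + _] := gt w; apply.
Qed.

End Matching.

(** * The homeomorphism of the plane *)

Section Limits.
Context {R : realType}.
Implicit Types (lo hi : seq bool -> R) (C D : set R) (L N : R -> R).

Lemma address_unique lo hi n x y : subdivision lo hi ->
  lo (address lo n x) <= y < hi (address lo n x) -> address lo n y = address lo n x.
Proof.
move=> S; elim: n => //= n IH yn.
have [l h] := subdiv_cons (lo (true :: address lo n x) <= x) (address lo n x) S.
rewrite IH; last by lra.
congr (_ :: _); move: yn; case: (lo (true :: _) <= x) => [/andP[->]//|].
by rewrite (subdiv_cut S) ltNge => /andP[_ /negbTE].
Qed.

Lemma reach_address_cvg C L lo hi x : hair_profile C L -> subdivision lo hi ->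
  lo [::] <= x < hi [::] ->
  (fun n => reach L (lo (address lo n x)) (hi (address lo n x))) @ \oo --> L x.
Proof.
move=> P S x0; apply/cvgrPdist_le => e e0.
have [d d0 Ld] := profile_usc P x e0.
have [n small] := subdiv_small S d0; exists n => // m /= nm.
have := small (address lo m x); rewrite size_address => /(_ nm).
have /andP[l h] := mem_address m S x0; move=> sm.
have up : reach L (lo (address lo m x)) (hi (address lo m x)) <= L x + e.
  apply: reach_le (ltW (subdiv_lt S _)) _ => t /andP[t1 t2].
  by apply/ltW/Ld; rewrite ltr_norml; lra.
have dn : L x <= reach L (lo (address lo m x)) (hi (address lo m x)).
  by apply: (reach_ub P); rewrite l ltW.
by rewrite ler_norml; lra.
Qed.

Lemma profile_reach_gt0 C L a b x : hair_profile C L -> C x -> a < x < b ->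
  0 < reach L a b.
Proof.
move=> P Cx axb; have [t tab Lt] := profile_dense P Cx axb.
by apply: lt_le_trans Lt _; apply: (reach_ub P); lra.
Qed.

(** The ends of the pieces must be off [C] in order that a point of [C] be interior
    to its pieces, where density of the positive lengths applies. *)
Lemma profile_memP C L lo hi x : hair_profile C L -> subdivision lo hi ->
  (forall w, ~ C (lo w)) -> lo [::] <= x < hi [::] ->
  C x <-> forall n, 0 < reach L (lo (address lo n x)) (hi (address lo n x)).
Proof.
move=> P S nC x0; split=> [Cx n|pos].
  apply: (profile_reach_gt0 P Cx); have /andP[l ->] := mem_address n S x0.
  rewrite lt_neqAle l !andbT; apply/eqP => E.
  by apply: (nC (address lo n x)); rewrite E.
apply: contrapT => nCx; have [d d0 Cd] := profile_off_near P nCx.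
have [n near_x] := subdiv_dist S x0 d0.
have := pos n; rewrite ltNge => /negP; apply.
apply: reach_le (ltW (subdiv_lt S _)) _ => t tn.
by rewrite (profile_off P (Cd _ (near_x _ tn))).
Qed.

(** The intervals of radius [2 * 2^-n] around the values along an address are
    nested, because [2 * 2^-n] is the sum of the bounds [2^-m] over [m >= n]. *)
Lemma log_ratio_limit lo (r : seq bool -> R) :
  (forall b w, `|r (b :: w) - r w| <= 2^-1 ^+ size w) ->
  exists g : R -> R, forall x n, `|g x - r (address lo n x)| <= 2 * 2^-1 ^+ n.
Proof.
move=> rS.
pose u x n := r (address lo n x) - 2 * 2^-1 ^+ n.
pose v x n := r (address lo n x) + 2 * 2^-1 ^+ n.
have e0 m : (0 : R) <= 2^-1 ^+ m by apply: exprn_ge0; lra.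
exists (fun x => sup (range (u x))) => x n.
have step m : `|r (address lo m.+1 x) - r (address lo m x)| <= 2^-1 ^+ m.
  by have := rS (lo (true :: address lo m x) <= x) (address lo m x);
    rewrite size_address.
have : u x n <= sup (range (u x)) <= v x n.
  apply: nested_sup => m; rewrite /u /v; last by have := e0 m; lra.
    by have := step m; rewrite ler_norml exprS; lra.
  by have := step m; rewrite ler_norml exprS; lra.
by rewrite ler_norml /u /v; lra.
Qed.

Lemma vertical_rescaling_homeomorphism (f f' G : R -> R) :
  cancel f f' -> cancel f' f -> continuous f -> continuous f' -> continuous G ->
  homeomorphism (fun p : R * R => (f p.1, expR (G p.1) * p.2)).
Proof.
move=> fK fK' cf cf' cG.
have cont (a b : R -> R) : continuous a -> continuous b ->
    continuous (fun p : R * R => (a p.1, expR (b p.1) * p.2)).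
  move=> ca cb p.
  apply: (@cvg_pair _ _ _ (nbhs p) (nbhs (a p.1)) (nbhs (expR (b p.1) * p.2))).
    by apply: (@cvg_comp _ _ _ fst a); [exact: cvg_fst | exact: ca].
  apply: cvgM; last exact: cvg_snd.
  apply: (@cvg_comp _ _ _ (b \o fst) expR); last exact: continuous_expR.
  by apply: (@cvg_comp _ _ _ fst b); [exact: cvg_fst | exact: cb].
exists (fun p => (f' p.1, expR (- G (f' p.1)) * p.2)); split.
- by case=> x y /=; rewrite fK mulrA -expRD addNr expR0 mul1r.
- by case=> x y /=; rewrite fK' mulrA -expRD addrN expR0 mul1r.
- exact: cont.
- apply: (cont f' (fun x => - G (f' x))) => // x; apply: cvgN.
  by apply: continuous_comp; [exact: cf' | exact: cG].
Qed.

End Limits.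

Section Homeomorphism.
Context {R : realType}.
Variables (C D : set R) (L N : R -> R) (t : seq bool -> @piece R).
Hypotheses (PL : hair_profile C L) (PN : hair_profile D N).
Let lo := @src_lo R \o t.
Let hi := @src_hi R \o t.
Let lo' := @tgt_lo R \o t.
Let hi' := @tgt_hi R \o t.
Hypotheses (mt : forall w, matched C D L N (t w)).
Hypotheses (S : subdivision lo hi) (S' : subdivision lo' hi').
Hypotheses (lo0 : lo' [::] = lo [::]) (hi0 : hi' [::] = hi [::]).
Hypothesis (bdC : forall x, C x -> lo [::] < x < hi [::]).
Hypothesis (bdD : forall x, D x -> lo [::] < x < hi [::]).

Let h := extend_transfer lo hi lo'.
Let k := extend_transfer lo' hi' lo.

(** Membership in the base is read off from the positivity of the reaches along
    the address, which is the same for both subdivisions. *)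
Lemma transfer_mem_iff x : C x <-> D (h x).
Proof.
rewrite /h /extend_transfer; case: ifPn => x0; last first.
  by split=> [/bdC|/bdD]; move: x0; lra.
have nC w : ~ C (lo w) by have [_ _ []] := mt w.
have nD w : ~ D (lo' w) by have [_ _ _ []] := mt w.
have x0' := mem_transfer S S' x0.
rewrite (profile_memP PL S nC x0) (profile_memP PN S' nD x0').
split=> pos n; have := pos n; rewrite (address_transfer S S' n x0);
  have [_ _ _ _ E] := mt (address lo n x);
  by rewrite /lo' /hi' /= E pmulr_rgt0 ?expR_gt0.
Qed.

(** Passage to the limit in the relation between the reaches of matched pieces.
    Outside the root both sides vanish. *)
Lemma transfer_height (g : R -> R) :
  (forall x n, `|g x - log_ratio (t (address lo n x))| <= 2 * 2^-1 ^+ n) ->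
  forall x, N (h x) = expR (g x) * L x.
Proof.
move=> gP x; rewrite /h /extend_transfer; case: ifPn => x0; last first.
  have nCx : ~ C x by move=> /bdC; move: x0; lra.
  have nDx : ~ D x by move=> /bdD; move: x0; lra.
  by rewrite (profile_off PL nCx) (profile_off PN nDx) mulr0.
have x0' := mem_transfer S S' x0.
have cL := reach_address_cvg PL S x0.
have cN := reach_address_cvg PN S' x0'.
have cg : (fun n => log_ratio (t (address lo n x))) @ \oo --> g x.
  apply/cvgrPdist_lt => e e0.
  have [n small] := @geometric_small R 2 2^-1 e ltac:(lra) e0.
  exists n => // m /= /small; rewrite ger0_norm//; exact: le_lt_trans (gP x m).
have ce : (fun n => expR (log_ratio (t (address lo n x)))) @ \oo --> expR (g x).
  by apply: continuous_cvg cg; exact: continuous_expR.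
apply: (cvg_unique _ cN) => //=.
suff -> : (fun n => reach N (lo' (address lo' n (transfer lo lo' x)))
                            (hi' (address lo' n (transfer lo lo' x)))) =
    (fun n => expR (log_ratio (t (address lo n x))) *
              reach L (lo (address lo n x)) (hi (address lo n x))).
  exact: cvgM ce cL.
apply/funext => n; rewrite (address_transfer S S' n x0).
by have [_ _ _ _ E] := mt (address lo n x).
Qed.

(** A point of [C] is never a cut, hence is interior to all its pieces, and on a
    piece of depth [n] the oscillation of [g] is at most [4 * 2^-n]. At the cuts
    themselves [g] may jump. *)
Lemma log_ratio_limit_continuous (g : R -> R) :
  (forall x n, `|g x - log_ratio (t (address lo n x))| <= 2 * 2^-1 ^+ n) ->
  {within C, continuous g}.
Proof.
move=> gP; apply/subspace_continuousP => x Cx; apply/cvgrPdist_lt => e e0.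
have [n small] := @geometric_small R 4 2^-1 e ltac:(lra) e0.
have {small} := small n (leqnn n); rewrite ger0_norm// => small.
have x0 : lo [::] <= x < hi [::] by have := bdC Cx; lra.
have /andP[l hx] := mem_address n S x0.
have lx : lo (address lo n x) < x.
  rewrite lt_neqAle l andbT; apply/eqP => E.
  by have [_ _ [+ _]] := mt (address lo n x); rewrite -[src_lo _]/(lo _) E.
apply: cvg_within; near=> y.
have yn : lo (address lo n x) <= y < hi (address lo n x).
  by apply/andP; split; [apply/ltW|]; near: y; [exact: lt_nbhsr | exact: lt_nbhsl].
have := gP y n; have := gP x n; rewrite (address_unique S yn).
(* The goal reads [g] as a function on the subspace [C]. *)
by rewrite !ler_norml [X in `|X| < _](_ : _ = g x - g y)// ltr_norml; move: small; lra.
Unshelve. all: by end_near. Qed.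

Hypothesis log_ratio_step :
  forall b w, `|log_ratio (t (b :: w)) - log_ratio (t w)| <= 2^-1 ^+ size w.

Lemma matched_hairs_homeomorphic : ambiently_homeomorphic (hairs C L) (hairs D N).
Proof.
have [g gP] := log_ratio_limit lo log_ratio_step.
have hK : cancel h k := extend_transferK S S' lo0 hi0.
have kK : cancel k h := extend_transferK S' S (esym lo0) (esym hi0).
have hh : {homo h : x y / x <= y} := extend_transfer_homo S S' lo0 hi0.
have kh : {homo k : x y / x <= y} := extend_transfer_homo S' S (esym lo0) (esym hi0).
have [] := @continuous_bounded_extension R R (@pseudometric_normal R R) C
  (profile_closed PL) g (`|log_ratio (t [::])| + 2) _ (log_ratio_limit_continuous gP).
- by rewrite ltr_wpDl.
- move=> x _; rewrite -[g x](subrK (log_ratio (t [::]))).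
  rewrite (le_trans (ler_normD _ _))// addrC lerD2l.
  by have := gP x 0%N; rewrite expr0 mulr1.
move=> G [gG cG _].
exists (fun p : R * R => (h p.1, expR (G p.1) * p.2)).
  apply: (vertical_rescaling_homeomorphism hK kK _ _ cG).
    exact: (homo_bij_continuous hK kK hh kh).
  exact: (homo_bij_continuous kK hK kh hh).
have hairsP x y : hairs D N (h x, expR (G x) * y) <-> hairs C L (x, y).
  rewrite /hairs /= -transfer_mem_iff; split=> -[Cx].
    rewrite (transfer_height gP) gG ?inE// pmulr_rge0 ?expR_gt0//.
    by rewrite ler_pM2l ?expR_gt0.
  rewrite (transfer_height gP) gG ?inE// pmulr_rge0 ?expR_gt0//.
  by rewrite ler_pM2l ?expR_gt0.
apply/seteqP; split=> [_ [[x y] xy <-] /=|[x y] xy]; first exact/hairsP.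
exists (k x, expR (- G (k x)) * y) => /=.
  by apply/hairsP; rewrite kK mulrA -expRD addrN expR0 mul1r.
by rewrite kK mulrA -expRD addrN expR0 mul1r.
Qed.

End Homeomorphism.

(** * From hairy Cantor sets to length functions *)

Section FromHairyCantorSets.
Context {R : realType}.
Implicit Types (C D : set R) (l L N : R -> R).

Lemma limsup_in_lt C l F (r s : R) : Filter F ->
  limsup_in C l F = r%:E -> r < s -> F [set t | C t -> l t < s].
Proof.
move=> FF lsup rs; have : (limsup_in C l F < s%:E)%E by rewrite lsup lte_fin.
move=> /ereal_inf_lt[_ [V FV <-] Vs]; apply: filterS FV => t Vt.
by rewrite -lte_fin; apply: le_lt_trans Vs; apply: ereal_sup_ubound; exists t.
Qed.

Lemma limsup_in_gt C l F (r s : R) V : Filter F ->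
  limsup_in C l F = r%:E -> s < r -> F V -> exists t, [/\ V t, C t & s < l t].
Proof.
move=> FF lsup sr FV.
have : (s%:E < ereal_sup [set (l t)%:E | t in V `&` C])%E.
  apply: lt_le_trans (_ : (r%:E <= _)%E); first by rewrite lte_fin.
  rewrite -lsup; apply: ereal_inf_lbound; exists (V `&` C) => //.
  by apply: filterS FV => t.
by move=> /ereal_sup_gt[_ [t [Vt Ct] <-]]; rewrite lte_fin => sl; exists t.
Qed.

Lemma usc_compact_bounded C L : compact C ->
  (forall x e, 0 < e ->
    exists2 d, 0 < d & forall t, `|t - x| < d -> L t < L x + e) ->
  exists B, forall x, C x -> L x <= B.
Proof.
move=> /compact_near_coveringP cC usc.
have near_le x : C x -> \forall x' \near x & B \near +oo%R, L x' <= B.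
  move=> Cx; have [d d0 Ld] := usc x 1 ltr01.
  exists (ball x d, [set B | L x + 1 < B]).
    split; first exact: nbhsx_ballx.
    by exists (L x + 1); split; [exact: num_real | ].
  move=> [t B] /= [xt LB]; apply: le_trans (ltW LB); apply/ltW/Ld.
  by rewrite distrC.
have [B [_ HB]] := cC R _ (fun B x => L x <= B) _ near_le.
by exists (B + 1) => x Cx; apply: (HB (B + 1)) => //; lra.
Qed.

Lemma totally_disconnected_codense C a b : totally_disconnected C -> a < b ->
  exists2 c, a < c < b & ~ C c.
Proof.
move=> tdC ab; apply: contrapT => /forall2NP abC.
have sub : `]a, b[ `<=` C.
  move=> c /=; rewrite in_itv /= => acb.
  by case: (abC c) => // /contrapT.
pose x := (a + b) / 2; have xab : `]a, b[%classic x by rewrite /= in_itv /= /x; lra.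
have yab : `]a, b[%classic ((a + x) / 2) by rewrite /= in_itv /= /x; lra.
have conn : connected `]a, b[%classic.
  by apply/connected_intervalP; exact: interval_is_interval.
have := connected_component_max xab sub conn yab.
by rewrite (tdC x (sub _ xab)) /= /x => E; lra.
Qed.

(** Besides translating the upper limits, this uses that a totally disconnected
    set contains no interval, and that an upper semicontinuous function is
    bounded on a compact set. *)
Lemma hairy_cantor_profile (X : set (R * R)) : straight_hairy_cantor_set X ->
  exists C L, [/\ hair_profile C L, C !=set0 & X = hairs C L].
Proof.
move=> [C [l [[[C0 cC pC tdC] l0 XE] [dense ends inner]]]].
pose L x := if `[< C x >] then l x else 0.
have LC x : C x -> L x = l x by move=> Cx; rewrite /L asboolT.
have LnC x : ~ C x -> L x = 0 by move=> nCx; rewrite /L asboolF.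
have L0 x : 0 <= L x.
  by have [Cx|nCx] := pselect (C x); [rewrite LC// l0 | rewrite LnC].
have clC : closed C by case: pC.
have usc x e : 0 < e -> exists2 d, 0 < d & forall t, `|t - x| < d -> L t < L x + e.
  move=> e0.
  have suff_near : (\forall t \near x, C t -> t != x -> l t < L x + e) ->
      exists2 d, 0 < d & forall t, `|t - x| < d -> L t < L x + e.
    move=> /nbhs_ballP[d /= d0 H]; exists d => // t td.
    have [->|tx] := eqVneq t x; first by rewrite ltrDl.
    have [Ct|nCt] := pselect (C t); last by rewrite (LnC t)// ltr_wpDl.
    by rewrite LC//; apply: H => //; rewrite /ball /= distrC.
  apply: suff_near.
  have [Cx|nCx] := pselect (C x); last first.
    have : nbhs x (~` C) by apply: open_nbhs_nbhs; split => //; exact: closed_openC.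
    by apply: filterS => t nCt /nCt.
  have lt_e : l x < L x + e by rewrite LC// ltrDl.
  have [ex|nex] := pselect (end_point C x).
    have [lx lsup] := ends x Cx ex.
    rewrite -lx in lsup; have np := limsup_in_lt _ lsup lt_e.
    have np' : nbhs x [set t | t != x -> C t -> l t < L x + e] by exact: np.
    by apply: filterS np' => t H Ct tx; exact: H.
  have [lsl lsr] := inner x Cx nex.
  have nl := limsup_in_lt _ lsl lt_e; have nr := limsup_in_lt _ lsr lt_e.
  have nl' : nbhs x [set t | t < x -> C t -> l t < L x + e] by exact: nl.
  have nr' : nbhs x [set t | x < t -> C t -> l t < L x + e] by exact: nr.
  apply: filterS2 nl' nr' => t Hl Hr Ct.
  by rewrite neq_lt => /orP[/Hl|/Hr]; exact.
(* Hairs of positive length do not stand on end points. *)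
have inner_pos x : 0 < L x -> C x /\ ~ end_point C x.
  move=> Lx; have Cx : C x by apply: contrapT => /LnC E; rewrite E ltxx in Lx.
  by split => // /(ends x Cx)[E _]; rewrite LC// E ltxx in Lx.
exists C, L; split => //; last first.
  rewrite XE /hairs; apply/seteqP; split=> p /= -[Cp]; by rewrite LC.
split => //.
- have /(compact_bounded)[M [_ HM]] := cC.
  exists (M + 2) => x Cx; have := HM (M + 1) ltac:(lra) x Cx.
  by rewrite /= ler_norml; lra.
- by move=> a b; exact: totally_disconnected_codense.
- have [B HB] := usc_compact_bounded cC usc.
  exists (Num.max B 0) => x; rewrite le_max.
  by have [/HB ->//|/LnC ->] := pselect (C x); rewrite lexx orbT.
- move=> a b x Cx xab.
  have nab : nbhs x `]a, b[%classic.
    by apply: open_nbhs_nbhs; split; [exact: itv_open | rewrite /= in_itv].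
  have [t [[Ct lt0] /=]] := dense x Cx _ nab; rewrite in_itv /= => tab.
  by exists t => //; rewrite LC.
- move=> x e d Lx e0 d0; have [Cx nex] := inner_pos x Lx.
  have [lsl _] := inner x Cx nex.
  have near_l : x^'- `]x - d, x[%classic.
    exists d => // t /= xt tx; rewrite in_itv /=.
    by move: xt; rewrite ltr_norml; lra.
  have [t [tx Ct lt_t]] := limsup_in_gt _ lsl (ltac:(lra) : l x - e < l x) near_l.
  by exists t; [rewrite /= in_itv in tx | rewrite !LC].
- move=> x e d Lx e0 d0; have [Cx nex] := inner_pos x Lx.
  have [_ lsr] := inner x Cx nex.
  have near_r : x^'+ `]x, x + d[%classic.
    exists d => // t /= xt tx; rewrite in_itv /=.
    by move: xt; rewrite ltr_norml; lra.
  have [t [tx Ct lt_t]] := limsup_in_gt _ lsr (ltac:(lra) : l x - e < l x) near_r.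
  by exists t; [rewrite /= in_itv in tx | rewrite !LC].
Qed.

(** The root is a common interval around both bases; the bases being nonempty,
    both reaches over it are positive and have a ratio. *)
Lemma hairs_homeomorphic C D L N : hair_profile C L -> hair_profile D N ->
  C !=set0 -> D !=set0 -> ambiently_homeomorphic (hairs C L) (hairs D N).
Proof.
move=> PL PN [c Cc] [d Dd].
have [K1 CK1] := profile_bounded PL; have [K2 DK2] := profile_bounded PN.
pose K := Num.max K1 K2.
have KK1 : K1 <= K by rewrite le_max lexx.
have KK2 : K2 <= K by rewrite le_max lexx orbT.
have CK x : C x -> - K < x < K by move=> /CK1; lra.
have DK x : D x -> - K < x < K by move=> /DK2; lra.
have L0 : 0 < reach L (- K) K := profile_reach_gt0 PL Cc (CK c Cc).
have N0 : 0 < reach N (- K) K := profile_reach_gt0 PN Dd (DK d Dd).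
have ltK : - K < K by have := CK c Cc; lra.
have [nCl nCr] : ~ C (- K) /\ ~ C K by split=> /CK; lra.
have [nDl nDr] : ~ D (- K) /\ ~ D K by split=> /DK; lra.
have m0 : matched C D L N
    (Piece (- K) K (- K) K (ln (reach N (- K) K / reach L (- K) K))).
  by split => //=; rewrite lnK ?posrE ?divr_gt0// divfK// gt_eqF.
have [t [t0 mt S S' step]] := matching_tree PL PN m0.
by apply: (@matched_hairs_homeomorphic _ C D L N t) => //=; rewrite t0.
Qed.

End FromHairyCantorSets.

Theorem theorem1p2 (R : realType) (X Y : set (R * R)) :
  straight_hairy_cantor_set X -> straight_hairy_cantor_set Y ->
  ambiently_homeomorphic X Y.
Proof.
move=> /hairy_cantor_profile[C [L [PL C0 ->]]].
move=> /hairy_cantor_profile[D [N [PN D0 ->]]].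
exact: hairs_homeomorphic.
Qed.
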